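(* Let $\mathbf{K}$ be an infinite structure and let $(\mathbf{M},\phi,\psi)$ be a weak bi-embedding for $\mathbf{K}$. Then for every expansion $\mathbf{M}^*$ of $\mathbf{M}$ and every $\mathbf{A}\in\mathrm{Age}(\mathbf{K})$, $$\mathrm{BRD}(\mathbf{A},\mathbf{K})\le\sum_{\mathbf{A}^*\in(\mathbf{M}^*\cdot\phi)(\mathbf{A},\mathbf{K})}\mathrm{BRD}(\mathbf{A}^*,\mathbf{M}^* ),$$ where $(\mathbf{M}^*\cdot\phi)(\mathbf{A},\mathbf{K})=\{\mathbf{M}^*\cdot(\phi\circ f): f\in\mathrm{Emb}(\mathbf{A},\mathbf{K})\}$ (the right-hand side is $\infty$ if this set is infinite or some summand is $\infty$).
   Context: Fix a relational language $\mathbb{L}$: a set of relation symbols $R$, each with an arity $n_R\ge 1$. A structure $\mathbf{A}$ consists of a set $A$ and subsets $R^{\mathbf{A}}\subseteq A^{n_R}$ for $R\in\mathbb{L}$; $\mathcal{L}_{\mathbf{A}}=\{R\in\mathbb{L}: R^{\mathbf{A}}\neq\emptyset\}$. An embedding $f:\mathbf{A}\to\mathbf{B}$ is an injection $f:A\to B$ such that for every $R$ of arity $n$ and $(a_0,\dots,a_{n-1})\in A^n$, $(a_0,\dots,a_{n-1})\in R^{\mathbf{A}}$ iff $(f(a_0),\dots,f(a_{n-1}))\in R^{\mathbf{B}}$. $\mathrm{Emb}(\mathbf{A},\mathbf{B})$ is the set of embeddings, $\mathrm{Emb}(\mathbf{K})=\mathrm{Emb}(\mathbf{K},\mathbf{K})$,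 $\mathbf{A}\le\mathbf{B}$ means $\mathrm{Emb}(\mathbf{A},\mathbf{B})\ne\emptyset$, and $\mathrm{Age}(\mathbf{K})$ is the class of finite $\mathbf{A}\le\mathbf{K}$. Numbers $r$ are identified with $\{0,\dots,r-1\}$. For an infinite structure $\mathbf{K}$ and $\mathbf{A}\in\mathrm{Age}(\mathbf{K})$, $\mathrm{BRD}(\mathbf{A},\mathbf{K})$ is the least $t<\omega$ such that for all $r<\omega$ and all $\chi:\mathrm{Emb}(\mathbf{A},\mathbf{K})\to r$ there is $g\in\mathrm{Emb}(\mathbf{K})$ with $|\chi[g\circ\mathrm{Emb}(\mathbf{A},\mathbf{K})]|\le t$ (and $\infty$ if none exists). For a structure $\mathbf{K}$, a set $S$ and an injection $\eta:S\to K$, $\mathbf{K}\cdot\eta$ is the unique structure on universe $S$ with $\eta\in\mathrm{Emb}(\mathbf{K}\cdot\eta,\mathbf{K})$. Given structures $\mathbf{K}^*,\mathbf{K}$ with the same universe, $\mathbf{K}^*$ is an expansion of $\mathbf{K}$ if $R^{\mathbf{K}^*}=R^{\mathbf{K}}$ for all $R\in\mathcal{L}_{\mathbf{K}}$. For a class $\mathcal{K}$ of finite structures and structures $\mathbf{B},\mathbf{C}$, a map $f:B\to C$ is a $\mathcal{K}$-approximate embedding if $f\circ\mathrm{Emb}(\mathbf{A},\mathbf{B})\subseteq\mathrm{Emb}(\mathbf{A},\mathbf{C})$ for every $\mathbf{A}\in\mathcal{K}$; $\mathrm{Emb}_{\mathbf{K}}(\mathbf{B},\mathbf{C})$ denotes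 the set of $\mathrm{Age}(\mathbf{K})$-approximate embeddings. A weak bi-embedding for an infinite structure $\mathbf{K}$ is a tuple $(\mathbf{M},\phi,\psi)$ with $\mathbf{M}$ an infinite structure, $\phi\in\mathrm{Emb}(\mathbf{K},\mathbf{M})$ and $\psi\in\mathrm{Emb}_{\mathbf{K}}(\mathbf{M},\mathbf{K})$. *)

(* Defs.v *)
From HB Require Import structures.
From mathcomp Require Import all_boot all_order all_algebra.
From mathcomp Require Import mathcomp_extra boolp classical_sets functions.
From mathcomp Require Import cardinality fsbigop constructive_ereal.

Set Implicit Arguments.
Unset Strict Implicit.
Unset Printing Implicit Defensive.

Local Open Scope classical_set_scope.
Local Open Scope card_scope.

Record language := Language {
  symbol :> Type;
  arity : symbol -> nat;
  arity_gt0 : forall R, 0 < arity R }.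

(* A structure is represented by its universe, a type [T], together with a
   term of [structure L T]; two structures on the same universe are equal iff
   they have the same relations (cf. [structureP]). *)
Definition structure (L : language) (T : Type) : Type :=
  forall R : L, set ((arity R).-tuple T).

HB.instance Definition _ (L : language) (T : Type) :=
  gen_eqMixin (structure L T).
HB.instance Definition _ (L : language) (T : Type) :=
  gen_choiceMixin (structure L T).

Lemma structureP (L : language) (T : Type) (A B : structure L T) :
  (forall R, A R = B R) -> A = B.
Proof. exact: functional_extensionality_dep. Qed.

Definition infinite_structure (L : language) (T : Type) (K : structure L T) :
  Prop := infinite_set [set: T].

Definition active_symbols (L : language) (T : Type) (A : structure L T) :
  set L := [set R | A R !=set0].

Definition Emb (L : language) (S T : Type)
    (A : structure L S) (B : structure L T) : set (S -> T) :=
  [set f | injective f /\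
     forall (R : L) (a : (arity R).-tuple S), A R a <-> B R (map_tuple f a)].

Definition embeds (L : language) (S T : Type)
  (A : structure L S) (B : structure L T) : Prop := Emb A B !=set0.

Definition structure_class (L : language) : Type :=
  forall T : Type, structure L T -> Prop.

Definition Age (L : language) (U : Type) (K : structure L U) :
    structure_class L :=
  fun (T : Type) (A : structure L T) => finite_set [set: T] /\ embeds A K.

(* [BRD_bound A K t] is the property whose least witness [t] is the big Ramsey
   degree.  A colouring is defined on embeddings only: its domain is the
   subtype associated with the set [Emb A K], and [val e] is the map
   underlying [e : Emb A K]. *)
Definition BRD_bound (L : language) (S T : Type)
    (A : structure L S) (K : structure L T) (t : nat) : Prop :=
  forall (r : nat) (chi : Emb A K -> 'I_r),
    exists2 g, Emb K K g &
      chi @` [set e | [set g \o f | f in Emb A K] (val e)] #<= `I_t.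

Definition is_least (P : nat -> Prop) (t : nat) : Prop :=
  P t /\ forall s, P s -> t <= s.

(* The values in omega + 1 are taken in [\bar int]; [-oo] and the negative
   integers are never reached. *)
Definition BRD (L : language) (S T : Type)
    (A : structure L S) (K : structure L T) : \bar int :=
  if pselect (exists t, BRD_bound A K t)
  then ((xget 0 (is_least (BRD_bound A K)))%:Z)%:E else +oo%E.

Lemma ex_least (P : nat -> Prop) : (exists t, P t) -> exists t, is_least P t.
Proof.
move=> [t Pt]; have exP : exists t, `[< P t >] by exists t; apply/asboolP.
case: (ex_minnP exP) => m /asboolP Pm minm.
by exists m; split=> // s Ps; apply: minm; apply/asboolP.
Qed.

Lemma BRD_finP (L : language) (S T : Type)
    (A : structure L S) (K : structure L T) (t : nat) :
  BRD A K = (t%:Z)%:E <-> is_least (BRD_bound A K) t.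
Proof.
rewrite /BRD; case: pselect => [exB|nexB]; last first.
  by split=> // -[Bt _]; case: nexB; exists t.
have [m mP] := ex_least exB.
have [Bx minx] : is_least (BRD_bound A K) (xget 0 (is_least (BRD_bound A K))).
  exact: (xgetI 0 mP).
split=> [[<-] //|[Bt mint]]; congr ((_%:Z)%:E).
by apply/eqP; rewrite eqn_leq minx // mint.
Qed.

Lemma BRD_inftyP (L : language) (S T : Type)
    (A : structure L S) (K : structure L T) :
  BRD A K = +oo%E <-> ~ exists t, BRD_bound A K t.
Proof. by rewrite /BRD; case: pselect => exB; split=> // /(_ exB). Qed.

Definition pullback (L : language) (S T : Type)
    (K : structure L T) (eta : S -> T) : structure L S :=
  fun R => [set a | K R (map_tuple eta a)].

(* For [eta] injective, [pullback K eta] is the structure K . eta: the unique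
   structure on [S] for which [eta] is an embedding into [K]. *)
Lemma pullback_uniqueP (L : language) (S T : Type)
    (K : structure L T) (eta : S -> T) (A : structure L S) :
  injective eta -> Emb A K eta <-> A = pullback K eta.
Proof.
move=> eta_inj; split=> [[_ AK]|->]; last by split.
by apply: structureP => R; apply/seteqP; split=> a /AK.
Qed.

Definition expansion (L : language) (T : Type) (K' K : structure L T) : Prop :=
  forall R : L, active_symbols K R -> K' R = K R.

Definition approx_embedding (L : language) (C : structure_class L) (T U : Type)
    (B : structure L T) (D : structure L U) : set (T -> U) :=
  [set f : T -> U | forall (S : Type) (A : structure L S), C S A ->
     [set f \o e | e in Emb A B] `<=` Emb A D].

Definition approx_Emb (L : language) (V : Type) (K : structure L V)
    (T U : Type) (B : structure L T) (D : structure L U) : set (T -> U) :=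
  approx_embedding (Age K) B D.

Definition weak_biembedding (L : language) (T U : Type)
    (K : structure L T) (M : structure L U) (phi : T -> U) (psi : U -> T) :
    Prop :=
  [/\ infinite_structure M, Emb K M phi & approx_Emb K M K psi].

(* [diagrams M' phi A K] is the set (M' . phi)(A, K). *)
Definition diagrams (L : language) (S T U : Type) (M' : structure L U)
    (phi : T -> U) (A : structure L S) (K : structure L T) :
    set (structure L S) :=
  [set pullback M' (phi \o f) | f in Emb A K].

(* Sum over an index set, with value +oo whenever the set is infinite. *)
Definition sum_over (I : choiceType) (X : set I) (F : I -> \bar int) :
    \bar int :=
  if pselect (finite_set X) then (\big[adde/0]_(i \in X) F i)%E else +oo%E.

(* Main.v *)
Require Import Defs.
From mathcomp Require Import all_boot all_order all_algebra.
From mathcomp Require Import finmap.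
From mathcomp Require Import boolp classical_sets cardinality fsbigop.
From mathcomp Require Import constructive_ereal.

(** Given a colouring [chi] of [Emb A K], colour the embeddings [h] into [M'] of
    each diagram [A'] of [A] by [chi (psi \o h)].  Treating the finitely many
    diagrams one after the other yields a single self-embedding [g] of [M'] such
    that, for every [A'], the embeddings [g \o h] with [h] in [Emb A' M'] take
    at most [BRD A' M'] colours.  Then [psi \o g \o phi] is a self-embedding of
    [K], because being an embedding is tested on finite substructures; and every
    [f] in [Emb A K] makes [phi \o f] an embedding of some diagram into [M'], so
    the numbers of colours add up. *)

Set Implicit Arguments.
Unset Strict Implicit.
Unset Printing Implicit Defensive.

Local Open Scope classical_set_scope.
Local Open Scope card_scope.

Section FiniteSets.
Context {I : choiceType}.
Implicit Types A B : set I.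

Lemma card_le_IIP A n :
  A #<= `I_n <-> finite_set A /\ (#|` fset_set A| <= n)%N.
Proof.
have cardA : finite_set A -> A #= `I_#|` fset_set A|.
  by move=> finA; rewrite -{1}(fset_setK finA); apply/card_eq_fsetP.
split=> [An|[finA leAn]].
  have finA : finite_set A := card_le_finite An (finite_II n).
  by split=> //; rewrite -card_le_II -(card_le_eql (cardA finA)).
by rewrite (card_le_eql (cardA finA)) card_le_II.
Qed.

Lemma card_le_setU A B m n :
  A #<= `I_m -> B #<= `I_n -> A `|` B #<= `I_(m + n)%N.
Proof.
move=> /card_le_IIP[finA Am] /card_le_IIP[finB Bn]; apply/card_le_IIP.
split; first by rewrite finite_setU.
rewrite fset_setU// cardfsU (leq_trans (leq_subr _ _))//; exact: leq_add.
Qed.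

(* The law in [sum_over] is [adde], convertible to the canonical addition of
   [\bar int] but not itself declared as a monoid law. *)
Lemma sum_over_finite A (F : I -> \bar int) :
  finite_set A -> sum_over A F = (\sum_(i <- fset_set A) F i)%E.
Proof.
move=> finA; rewrite /sum_over; case: pselect => // ?.
exact: (@fsbig_finite _ _ (@GRing.add (\bar int))).
Qed.

Lemma sum_over_infinite A (F : I -> \bar int) :
  infinite_set A -> sum_over A F = +oo%E.
Proof. by rewrite /sum_over; case: pselect. Qed.

End FiniteSets.

Section Embeddings.
Context {L : language}.

Lemma map_tuple_comp n (S T U : Type) (g : T -> U) (f : S -> T)
    (a : n.-tuple S) :
  map_tuple (g \o f) a = map_tuple g (map_tuple f a).
Proof. by apply: val_inj; rewrite /= map_comp. Qed.

Lemma Emb_id (T : Type) (K : structure L T) : Emb K K id.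
Proof.
split=> // R a; suff -> : map_tuple id a = a by [].
by apply: val_inj; rewrite /= map_id.
Qed.

Lemma Emb_comp (S T U : Type) (A : structure L S) (B : structure L T)
    (C : structure L U) g f : Emb B C g -> Emb A B f -> Emb A C (g \o f).
Proof.
move=> [ginj gE] [finj fE]; split; first exact: inj_comp.
by move=> R a; rewrite fE gE map_tuple_comp.
Qed.

Lemma Emb_pullback (S T : Type) (K : structure L T) (eta : S -> T) :
  injective eta -> Emb (pullback K eta) K eta.
Proof. by []. Qed.

(* A symbol inactive in [M] is also empty in every structure embedding in [M],
   so only the symbols on which [M'] and [M] agree matter. *)
Lemma expansion_Emb (S U : Type) (A A' : structure L S)
    (M M' : structure L U) f h : expansion M' M ->
  Emb A M f -> Emb A' M' f -> Emb A' M' h -> Emb A M h.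
Proof.
move=> M'M [_ AM] [_ A'f] [hinj A'h]; split=> // R a.
have [MR|MR] := pselect (active_symbols M R).
  by rewrite AM -(M'M _ MR) -A'f A'h.
rewrite AM; split=> Ma; by case: MR; eexists; exact: Ma.
Qed.

Lemma Age_pullback_val (T : Type) (K : structure L T) (D : set T) :
  finite_set D -> Age K (pullback K (val : D -> T)).
Proof.
move=> finD; split; last by exists val; apply: Emb_pullback; exact: val_inj.
by rewrite -(eq_finite_set (card_esym (card_setT D))).
Qed.

(** Injectivity and each instance of a relation involve finitely many points of [K]; the
    substructure on these points lies in [Age K], where the hypothesis on [psi] applies. *)
Lemma approx_Emb_comp (T U V : Type) (K : structure L T) (B : structure L U)
    (C : structure L V) psi e :
  approx_Emb K B C psi -> Emb K B e -> Emb K C (psi \o e).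
Proof.
move=> Kpsi Ke.
have fin_emb (D : set T) : finite_set D ->
    Emb (pullback K (val : D -> T)) C (psi \o (e \o val)).
  move=> finD; apply: (Kpsi _ _ (Age_pullback_val K finD)).
  exists (e \o val) => //; apply: Emb_comp Ke _.
  by apply: Emb_pullback; exact: val_inj.
split=> [x y|R a].
  have [inj _] := fin_emb _ (finite_set2 x y).
  have xD : x \in [set x; y] by apply/mem_set; left.
  have yD : y \in [set x; y] by apply/mem_set; right.
  by move=> exy; have [] := inj (SigSub xD) (SigSub yD) exy.
(* The tuple [a] is lifted to a tuple [b] over the finite set of its own entries. *)
have aD i : tnth a i \in range (tnth a) by apply/mem_set; exists i.
pose b := [tuple SigSub (aD i) | i < arity R].
have valb : map_tuple val b = a.
  by apply: eq_from_tnth => i; rewrite tnth_map tnth_mktuple.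
have [_ /(_ R b)] := fin_emb (range (tnth a)) (finite_image _ finite_finset).
rewrite -[psi \o (e \o val)]/((psi \o e) \o val) (map_tuple_comp (psi \o e)).
by rewrite /pullback /= valb.
Qed.

End Embeddings.

Section BigRamseyDegree.
Context {L : language}.

(** Colouring all maps, not only embeddings, lets colourings be composed with maps without carrying
    membership proofs. *)
Lemma BRD_bound_total (S T : Type) (A : structure L S) (K : structure L T)
    (t r : nat) (c : (S -> T) -> 'I_r) :
  BRD_bound A K t ->
  exists2 g, Emb K K g & c @` [set g \o f | f in Emb A K] #<= `I_t.
Proof.
move=> /(_ r (c \o val))[g Kg gt]; exists g => //.
apply: card_le_trans gt; apply: subset_card_le => _ [_ [f Af <-] <-].
have gf : g \o f \in Emb A K by apply/mem_set; exact: Emb_comp Kg Af.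
by exists (SigSub gf) => //=; exists f.
Qed.

Lemma BRD_bound_seq (S U : Type) (M : structure L U)
    (s : seq (structure L S)) (t : structure L S -> nat) (r : nat)
    (c : (S -> U) -> 'I_r) :
  (forall A, A \in s -> BRD_bound A M (t A)) ->
  exists2 g, Emb M M g &
    c @` [set g \o h | h in \bigcup_(A in [set` s]) Emb A M]
      #<= `I_(\sum_(A <- s) t A)%N.
Proof.
elim: s => [|A s IH] st.
  exists id; first exact: Emb_id.
  rewrite big_nil II0; apply/card_le0P; apply/seteqP; split=> //.
  by move=> x [y [h [A /=]]].
have [|g Mg gs] := IH.
  by move=> B Bs; apply: st; rewrite inE Bs orbT.
(* The colouring is shifted by [g], so [g'] handles the head. The bound for the tail survives
   composition with [g'], since [g' \o h] embeds the same structure as [h]. *)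
have [g' Mg' g't] :=
  BRD_bound_total (fun h => c (g \o h)) (st A (mem_head A s)).
exists (g \o g'); first exact: Emb_comp Mg Mg'.
rewrite big_cons; apply: card_le_trans (card_le_setU g't gs).
apply: subset_card_le => _ [_ [h [B /= Bs Bh] <-] <-].
move: Bs; rewrite inE => /orP[/eqP BA|Bs].
  by left; exists (g' \o h) => //; exists h => //; rewrite -BA.
right; exists (g \o (g' \o h)) => //; exists (g' \o h) => //.
by exists B => //; exact: Emb_comp Mg' Bh.
Qed.

Lemma BRD_bound_diagrams (S T U : Type) (K : structure L T)
    (M M' : structure L U) (phi : T -> U) (psi : U -> T) (A : structure L S)
    (s : seq (structure L S)) (t : structure L S -> nat) :
  weak_biembedding K M phi psi -> expansion M' M -> Age K A ->
  diagrams M' phi A K = [set` s] ->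
  (forall A', A' \in s -> BRD_bound A' M' (t A')) ->
  BRD_bound A K (\sum_(A' <- s) t A')%N.
Proof.
move=> [_ Kphi Kpsi] M'M AK diagE st r chi.
have [_ [f0 /mem_set Af0]] := AK.
(* The colour of [f0] serves as default value, since ['I_r] might be empty a priori; it is never met
   on the maps compared below. *)
pose c (h : S -> T) := if pselect (h \in Emb A K) is left Ah
  then chi (SigSub Ah) else chi (SigSub Af0).
have [g M'g gs] := BRD_bound_seq (fun h => c (psi \o h)) st.
have phi_inj : injective phi by case: Kphi.
(* Both [phi] and [g \o phi] induce the structure [pullback M' phi] on [T], so [g \o phi] inherits
   from [phi] that it embeds [K] in [M]. *)
have Kg : Emb K M (g \o phi).
  apply: (expansion_Emb M'M Kphi (Emb_pullback M' phi_inj)).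
  exact: Emb_comp M'g (Emb_pullback M' phi_inj).
exists (psi \o (g \o phi)); first exact: approx_Emb_comp Kpsi Kg.
apply: card_le_trans gs; apply: subset_card_le => _ [e [f Af fe] <-].
exists (g \o (phi \o f)).
  exists (phi \o f) => //; exists (pullback M' (phi \o f)).
    by rewrite -diagE; exists f.
  by apply: Emb_pullback; apply: inj_comp => //; case: Af.
rewrite /c; case: pselect => [Ah|].
  by congr chi; apply: val_inj; rewrite /= -fe.
have -> : psi \o (g \o (phi \o f)) = val e by rewrite -fe.
by case; exact: (valP e).
Qed.

Lemma BRD_le (S T : Type) (A : structure L S) (K : structure L T) (t : nat) :
  BRD_bound A K t -> (BRD A K <= (t%:Z)%:E)%E.
Proof.
move=> At; have [m mP] := ex_least (ex_intro _ t At).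
have -> : BRD A K = (m%:Z)%:E by apply/BRD_finP.
by rewrite lee_fin lez_nat; case: mP => _; apply.
Qed.

Lemma BRD_cases (S T : Type) (A : structure L S) (K : structure L T) :
  BRD A K = +oo%E \/ exists2 t : nat, BRD A K = (t%:Z)%:E & BRD_bound A K t.
Proof.
have [exB|nexB] := pselect (exists t, BRD_bound A K t).
  by have [m mP] := ex_least exB; right; exists m; [apply/BRD_finP|case: mP].
by left; apply/BRD_inftyP.
Qed.

End BigRamseyDegree.

Theorem theorem3p10 (L : language) (T U : Type)
    (K : structure L T) (M : structure L U) (phi : T -> U) (psi : U -> T)
    (K_infinite : infinite_structure K)
    (M_biemb : weak_biembedding K M phi psi)
    (M' : structure L U) (M'_expansion : expansion M' M)
    (S : Type) (A : structure L S) (A_Age : Age K A) :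
  (BRD A K <=
   sum_over (diagrams M' phi A K)
     (fun A' : structure L S => BRD A' M'))%E.
Proof.
have [finD|infD] := pselect (finite_set (diagrams M' phi A K)); last first.
  by rewrite sum_over_infinite// leey.
rewrite sum_over_finite//; set s := fset_set _.
have [[B Bs BMoo]|noty] := pselect (exists2 B, B \in s & BRD B M' = +oo%E).
  suff -> : (\sum_(B <- s) BRD B M' = +oo)%E by exact: leey.
  (* An infinite summand forces an infinite sum once [-oo] is excluded. *)
  apply/esum_eqyP; last by exists B.
  by move=> C _; have [->|[t -> _]] := BRD_cases C M'.
have exB B : exists t : nat,
    B \in s -> BRD B M' = (t%:Z)%:E /\ BRD_bound B M' t.
  have [BMoo|[t Bt tB]] := BRD_cases B M'; last by exists t.
  (* An infinite degree occurs only outside [s], where the value [0] is arbitrary. *)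
  by exists 0%N => Bs; case: noty; exists B.
have [t tP] := choice exB.
have -> : (\sum_(B <- s) BRD B M' = ((\sum_(B <- s) t B)%N%:Z)%:E)%E.
  rewrite big_seq (eq_bigr (fun B => ((t B)%:Z)%:E)); last by move=> B /tP[].
  by rewrite -big_seq sumEFin (big_morph Posz PoszD (erefl _)).
apply/BRD_le/(BRD_bound_diagrams M_biemb M'_expansion A_Age).
  by rewrite fset_setK.
by move=> B /tP[].
Qed.
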